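(* Let $M$ be a bicomplex Hilbert space and let $\psi,\phi\in M$. Then $$|(\psi,\phi)|\leq\sqrt{2}\,\|\psi\|\,\|\phi\|.$$
   Context: Bicomplex numbers: $\mathbb{T}=\{z_1+z_2\mathbf{i_2} : z_1,z_2\in\mathbb{C}(\mathbf{i_1})\}$ with $\mathbb{C}(\mathbf{i_1})=\{x+y\mathbf{i_1}: x,y\in\mathbb{R}\}$, $\mathbf{i_1}^2=\mathbf{i_2}^2=-1$, $\mathbf{j}=\mathbf{i_1}\mathbf{i_2}=\mathbf{i_2}\mathbf{i_1}$, $\mathbf{j}^2=1$; this is a commutative ring. Put $\mathbf{e_1}=(1+\mathbf{j})/2$, $\mathbf{e_2}=(1-\mathbf{j})/2$, so $\mathbf{e_1}+\mathbf{e_2}=1$, $\mathbf{e_1}\mathbf{e_2}=0$, $\mathbf{e_k}^2=\mathbf{e_k}$. Each $w\in\mathbb{T}$ is uniquely $w=z_{\widehat 1}\mathbf{e_1}+z_{\widehat 2}\mathbf{e_2}$ with $z_{\widehat k}\in\mathbb{C}(\mathbf{i_1})$; put $P_k(w)=z_{\widehat k}$, $w^{\dagger_3}=\bar z_{\widehat 1}\mathbf{e_1}+\bar z_{\widehat 2}\mathbf{e_2}$ (bar = complex conjugation in $\mathbb{C}(\mathbf{i_1})$), and $|w|=\frac{1}{\sqrt2}\sqrt{|z_{\widehat 1}|^2+|z_{\widehat 2}|^2}$ (the Euclidean norm on $\mathbb{R}^4$). Let $\mathbb{D}^+=\{x_{\widehat 1}\mathbf{e_1}+x_{\widehat 2}\mathbf{e_2}: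 x_{\widehat 1},x_{\widehat 2}\in\mathbb{R},\ x_{\widehat 1},x_{\widehat 2}\ge 0\}$. A bicomplex scalar product on a $\mathbb{T}$-module $M$ is a map $(\cdot,\cdot):M\times M\to\mathbb{T}$ such that for all $\psi,\phi,\chi\in M$, $\alpha\in\mathbb{T}$: (1) $(\psi,\phi+\chi)=(\psi,\phi)+(\psi,\chi)$; (2) $(\psi,\alpha\phi)=\alpha(\psi,\phi)$; (3) $(\psi,\phi)=(\phi,\psi)^{\dagger_3}$; (4) $(\psi,\psi)=0\Leftrightarrow\psi=0$. Standing assumption: it is hyperbolic positive, i.e. $(\psi,\psi)\in\mathbb{D}^+$ for all $\psi\in M$. Then $\{M,(\cdot,\cdot)\}$ is called a bicomplex pre-Hilbert space (or $\mathbb{T}$-inner product space). Write $(\cdot,\cdot)_{\widehat k}=P_k((\cdot,\cdot))$. The induced $\mathbb{T}$-norm is $\|\phi\|=\frac{1}{\sqrt2}\sqrt{(\mathbf{e_1}\phi,\mathbf{e_1}\phi)_{\widehat 1}+(\mathbf{e_2}\phi,\mathbf{e_2}\phi)_{\widehat 2}}$. A bicomplex Hilbert space is a $\mathbb{T}$-inner product space that is complete with respect to $\|\cdot\|$. *)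

(* Defs.v *)
From HB Require Import structures.
From mathcomp Require Import all_boot all_order all_algebra.
From mathcomp Require Import reals.
From mathcomp Require Import complex.
From mathcomp Require Import ring.

Set Implicit Arguments.
Unset Strict Implicit.
Unset Printing Implicit Defensive.

Import Order.TTheory GRing.Theory Num.Theory.
Local Open Scope ring_scope.
Local Open Scope complex_scope.

(* [Bicomplex z1 z2] is z1 + z2 i2, where the field R[i] plays the role of
   C(i1); the imaginary unit 'i of R[i] is i1. *)
Record bicomplex (R : Type) : Type := Bicomplex { bc1 : R[i]; bc2 : R[i] }.

Definition bc_to_pair (R : Type) (w : bicomplex R) : R[i] * R[i] :=
  (bc1 w, bc2 w).
Definition bc_of_pair (R : Type) (p : R[i] * R[i]) : bicomplex R :=
  Bicomplex p.1 p.2.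

Lemma bc_to_pairK (R : Type) : cancel (@bc_to_pair R) (@bc_of_pair R).
Proof. by case. Qed.

HB.instance Definition _ (R : eqType) := Equality.copy (bicomplex R)
  (can_type (@bc_to_pairK R)).
HB.instance Definition _ (R : choiceType) := Choice.copy (bicomplex R)
  (can_type (@bc_to_pairK R)).

Section BicomplexRing.
Variable R : rcfType.
Implicit Types u v w : bicomplex R.

Definition bc_zero : bicomplex R := Bicomplex 0 0.
Definition bc_one : bicomplex R := Bicomplex 1 0.
Definition bc_opp w := Bicomplex (- bc1 w) (- bc2 w).
Definition bc_add v w := Bicomplex (bc1 v + bc1 w) (bc2 v + bc2 w).
Definition bc_mul v w :=
  Bicomplex (bc1 v * bc1 w - bc2 v * bc2 w) (bc1 v * bc2 w + bc2 v * bc1 w).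

Lemma bc_addA : associative bc_add.
Proof. by move=> u v w; rewrite /bc_add /= !addrA. Qed.
Lemma bc_addC : commutative bc_add.
Proof. by move=> v w; rewrite /bc_add; congr Bicomplex; rewrite addrC. Qed.
Lemma bc_add0 : left_id bc_zero bc_add.
Proof. by case=> a b; rewrite /bc_add /= !add0r. Qed.
Lemma bc_addN : left_inverse bc_zero bc_opp bc_add.
Proof. by move=> w; rewrite /bc_add /= !addNr. Qed.

HB.instance Definition _ :=
  GRing.isZmodule.Build (bicomplex R) bc_addA bc_addC bc_add0 bc_addN.

Lemma bc_mulA : associative bc_mul.
Proof. by move=> u v w; rewrite /bc_mul /=; congr Bicomplex; ring. Qed.
Lemma bc_mulC : commutative bc_mul.
Proof. by move=> v w; rewrite /bc_mul /=; congr Bicomplex; ring. Qed.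
Lemma bc_mul1 : left_id bc_one bc_mul.
Proof. by case=> a b; rewrite /bc_mul /=; congr Bicomplex; ring. Qed.
Lemma bc_mulDl : left_distributive bc_mul bc_add.
Proof. by move=> u v w; rewrite /bc_mul /bc_add /=; congr Bicomplex; ring. Qed.
Lemma bc_one_neq0 : bc_one != 0.
Proof. by apply/eqP => -[] /eqP; rewrite oner_eq0. Qed.

HB.instance Definition _ := GRing.Zmodule_isComNzRing.Build (bicomplex R)
  bc_mulA bc_mulC bc_mul1 bc_mulDl bc_one_neq0.

End BicomplexRing.

Section Bicomplex.
Variable R : rcfType.
Implicit Types (z : R[i]) (w : bicomplex R).

Definition bc_of_complex z : bicomplex R := Bicomplex z 0.

Definition bc_i1 : bicomplex R := bc_of_complex 'i%C.
Definition bc_i2 : bicomplex R := Bicomplex 0 1.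
Definition bc_j : bicomplex R := bc_i1 * bc_i2.
Definition bc_e1 : bicomplex R := bc_of_complex 2^-1 * (1 + bc_j).
Definition bc_e2 : bicomplex R := bc_of_complex 2^-1 * (1 - bc_j).

(* The idempotent components; [bc_idempotentE] and [bc_idempotent_inj] below
   show that they are the unique complex coefficients of w on e1 and e2. *)
Definition bc_P1 w : R[i] := bc1 w - 'i%C * bc2 w.
Definition bc_P2 w : R[i] := bc1 w + 'i%C * bc2 w.

Definition bc_dagger3 w : bicomplex R :=
  bc_of_complex (bc_P1 w)^* * bc_e1 + bc_of_complex (bc_P2 w)^* * bc_e2.

(* [Normc.normc] is the R-valued modulus of a complex number. *)
Definition bc_norm w : R :=
  (Num.sqrt 2)^-1 *
  Num.sqrt (Normc.normc (bc_P1 w) ^+ 2 + Normc.normc (bc_P2 w) ^+ 2).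

Definition hyperbolic_nonneg w : Prop :=
  exists x1 x2 : R, [/\ 0 <= x1, 0 <= x2
    & w = bc_of_complex x1%:C * bc_e1 + bc_of_complex x2%:C * bc_e2].

Lemma bc_i1_sqr : bc_i1 ^+ 2 = - 1.
Proof.
rewrite expr2; congr Bicomplex; rewrite /= ?mulr0 ?mul0r ?subr0 ?addr0 ?oppr0 //.
apply/eqP; rewrite eq_complex /=.
by rewrite !(mulr0, mul0r, mulr1, add0r, addr0, sub0r, oppr0) !eqxx.
Qed.

Lemma bc_i2_sqr : bc_i2 ^+ 2 = - 1.
Proof. by rewrite expr2; congr Bicomplex; rewrite /=; ring. Qed.

Lemma bicomplexE w : w = bc_of_complex (bc1 w) + bc_of_complex (bc2 w) * bc_i2.
Proof. by case: w => a b; congr Bicomplex; rewrite /=; ring. Qed.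

Lemma sqr_ic : 'i%C * 'i%C = -1 :> R[i].
Proof. by rewrite -expr2 sqr_i. Qed.

Lemma half2c : 2^-1 + 2^-1 = 1 :> R[i].
Proof. by rewrite -mulr2n -[_ *+ 2]mulr_natr mulVf // pnatr_eq0. Qed.

Lemma bc_e1E : bc_e1 = Bicomplex 2^-1 (2^-1 * 'i%C).
Proof.
by congr Bicomplex;
  rewrite /= !(mulr0, mul0r, mulr1, subr0, add0r, addr0, sub0r, mulrN).
Qed.

Lemma bc_e2E : bc_e2 = Bicomplex 2^-1 (- (2^-1 * 'i%C)).
Proof.
by congr Bicomplex;
  rewrite /= !(mulr0, mul0r, mulr1, subr0, add0r, addr0, sub0r, mulrN).
Qed.

Lemma bc_P1E z1 z2 :
  bc_P1 (bc_of_complex z1 * bc_e1 + bc_of_complex z2 * bc_e2) = z1.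
Proof.
rewrite bc_e1E bc_e2E /bc_P1 /=.
transitivity (2^-1 * (z1 + z2) - ('i%C * 'i%C) * 2^-1 * (z1 - z2));
  first by ring.
by rewrite sqr_ic; transitivity ((2^-1 + 2^-1) * z1); [ring | rewrite half2c mul1r].
Qed.

Lemma bc_P2E z1 z2 :
  bc_P2 (bc_of_complex z1 * bc_e1 + bc_of_complex z2 * bc_e2) = z2.
Proof.
rewrite bc_e1E bc_e2E /bc_P2 /=.
transitivity (2^-1 * (z1 + z2) + ('i%C * 'i%C) * 2^-1 * (z1 - z2));
  first by ring.
by rewrite sqr_ic; transitivity ((2^-1 + 2^-1) * z2); [ring | rewrite half2c mul1r].
Qed.

Lemma bc_idempotentE w :
  w = bc_of_complex (bc_P1 w) * bc_e1 + bc_of_complex (bc_P2 w) * bc_e2.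
Proof.
case: w => a b; rewrite bc_e1E bc_e2E /bc_P1 /bc_P2; congr Bicomplex; rewrite /=.
  by transitivity ((2^-1 + 2^-1) * a); [rewrite half2c mul1r | ring].
transitivity (- ('i%C * 'i%C) * (2^-1 + 2^-1) * b); last by ring.
by rewrite sqr_ic half2c opprK !mul1r.
Qed.

Lemma bc_idempotent_inj z1 z2 w :
  w = bc_of_complex z1 * bc_e1 + bc_of_complex z2 * bc_e2 ->
  bc_P1 w = z1 /\ bc_P2 w = z2.
Proof. by move=> ->; rewrite bc_P1E bc_P2E. Qed.

Lemma bc_norm_euclidean w :
  bc_norm w = Num.sqrt (complex.Re (bc1 w) ^+ 2 + complex.Im (bc1 w) ^+ 2
                        + complex.Re (bc2 w) ^+ 2 + complex.Im (bc2 w) ^+ 2).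
Proof.
case: w => -[a b] [c d]; rewrite /bc_norm /bc_P1 /bc_P2 /=.
rewrite !sqr_sqrtr ?addr_ge0 ?sqr_ge0 //.
set s := (X in _ * Num.sqrt X = _).
have -> : s = 2 * (a ^+ 2 + b ^+ 2 + c ^+ 2 + d ^+ 2) by rewrite /s; ring.
rewrite sqrtrM ?ler0n // mulrA mulVf ?mul1r //.
by rewrite gt_eqF // sqrtr_gt0 ltr0n.
Qed.

End Bicomplex.

Arguments bc_i1 {R}.
Arguments bc_i2 {R}.
Arguments bc_j {R}.
Arguments bc_e1 {R}.
Arguments bc_e2 {R}.

Section BicomplexHilbert.
Variables (R : realType) (M : lmodType (bicomplex R)).
Implicit Type ip : M -> M -> bicomplex R.

Record bicomplex_scalar_product ip : Prop := BicomplexScalarProduct {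
  bcspDr : forall psi phi chi : M, ip psi (phi + chi) = ip psi phi + ip psi chi;
  bcspZr : forall (alpha : bicomplex R) (psi phi : M),
    ip psi (alpha *: phi) = alpha * ip psi phi;
  bcsp_dagger3 : forall psi phi : M, ip psi phi = bc_dagger3 (ip phi psi);
  bcsp_eq0 : forall psi : M, ip psi psi = 0 <-> psi = 0;
}.

Record bicomplex_prehilbert ip : Prop := BicomplexPrehilbert {
  bcph_scalar_product : bicomplex_scalar_product ip;
  bcph_hyperbolic_nonneg : forall psi : M, hyperbolic_nonneg (ip psi psi);
}.

(* In a pre-Hilbert space both components under the square root are
   nonnegative real numbers, hence equal to their real parts. *)
Definition tnorm ip (phi : M) : R :=
  (Num.sqrt 2)^-1 *
  Num.sqrt (complex.Re (bc_P1 (ip (bc_e1 *: phi) (bc_e1 *: phi)))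
            + complex.Re (bc_P2 (ip (bc_e2 *: phi) (bc_e2 *: phi)))).

Definition tnorm_cauchy ip (u : nat -> M) : Prop :=
  forall eps : R, 0 < eps -> exists N : nat, forall m n : nat,
    (N <= m)%N -> (N <= n)%N -> tnorm ip (u m - u n) < eps.

Definition tnorm_cvg ip (u : nat -> M) (l : M) : Prop :=
  forall eps : R, 0 < eps -> exists N : nat, forall n : nat,
    (N <= n)%N -> tnorm ip (u n - l) < eps.

Definition tnorm_complete ip : Prop :=
  forall u : nat -> M, tnorm_cauchy ip u -> exists l : M, tnorm_cvg ip u l.

Record bicomplex_hilbert ip : Prop := BicomplexHilbert {
  bch_prehilbert : bicomplex_prehilbert ip;
  bch_complete : tnorm_complete ip;
}.

End BicomplexHilbert.

(* Main.v *)
(* The idempotent component P_k of the scalar product is a positive semidefinite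
   Hermitian form over C(i1), so it satisfies Cauchy-Schwarz in the form
   |c_k|^2 <= a_k b_k. Summing over k, a_1 b_1 + a_2 b_2 <=
   (a_1 + a_2) (b_1 + b_2), and the right-hand side is 4 |psi|^2 |phi|^2. *)
From HB Require Import structures.
Require Import Defs.
From mathcomp Require Import all_boot all_order all_algebra.
From mathcomp Require Import reals.
From mathcomp Require Import complex ring.

Set Implicit Arguments.
Unset Strict Implicit.

Import Order.TTheory GRing.Theory Num.Theory.
Local Open Scope ring_scope.
Local Open Scope complex_scope.

Section IdempotentComponents.
Variable R : rcfType.
Implicit Types (z : R[i]) (w : bicomplex R).

Lemma bc_P1_is_zmod_morphism : zmod_morphism (@bc_P1 R).
Proof. by move=> v w; rewrite /bc_P1 /=; ring. Qed.

Lemma bc_P1_is_monoid_morphism : monoid_morphism (@bc_P1 R).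
Proof.
split=> [|v w]; rewrite /bc_P1 /=; first by rewrite mulr0 subr0.
(* [ring] treats ['i] as an atom, so the relation ['i * 'i = -1] is put in by hand; both sides are
   then equal as polynomials in ['i]. *)
have -> : bc2 v * bc2 w = - ('i%C * 'i%C) * (bc2 v * bc2 w).
  by rewrite sqr_ic opprK mul1r.
by ring.
Qed.

HB.instance Definition _ := GRing.isZmodMorphism.Build (bicomplex R) R[i]
  (@bc_P1 R) bc_P1_is_zmod_morphism.
HB.instance Definition _ := GRing.isMonoidMorphism.Build (bicomplex R) R[i]
  (@bc_P1 R) bc_P1_is_monoid_morphism.

Lemma bc_P2_is_zmod_morphism : zmod_morphism (@bc_P2 R).
Proof. by move=> v w; rewrite /bc_P2 /=; ring. Qed.

Lemma bc_P2_is_monoid_morphism : monoid_morphism (@bc_P2 R).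
Proof.
split=> [|v w]; rewrite /bc_P2 /=; first by rewrite mulr0 addr0.
have -> : bc2 v * bc2 w = - ('i%C * 'i%C) * (bc2 v * bc2 w).
  by rewrite sqr_ic opprK mul1r.
by ring.
Qed.

HB.instance Definition _ := GRing.isZmodMorphism.Build (bicomplex R) R[i]
  (@bc_P2 R) bc_P2_is_zmod_morphism.
HB.instance Definition _ := GRing.isMonoidMorphism.Build (bicomplex R) R[i]
  (@bc_P2 R) bc_P2_is_monoid_morphism.

Lemma bc_P1_of_complex z : bc_P1 (bc_of_complex z) = z.
Proof. by rewrite /bc_P1 /= mulr0 subr0. Qed.

Lemma bc_P2_of_complex z : bc_P2 (bc_of_complex z) = z.
Proof. by rewrite /bc_P2 /= mulr0 addr0. Qed.

Lemma bc_P1_e1 : bc_P1 (bc_e1 : bicomplex R) = 1.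
Proof. by rewrite bc_e1E /bc_P1 /= mulrCA sqr_ic mulrN1 opprK half2c. Qed.

Lemma bc_P2_e2 : bc_P2 (bc_e2 : bicomplex R) = 1.
Proof. by rewrite bc_e2E /bc_P2 /= mulrN mulrCA sqr_ic mulrN1 opprK half2c. Qed.

Lemma bc_P1_dagger3 w : bc_P1 (bc_dagger3 w) = (bc_P1 w)^*.
Proof. exact: bc_P1E. Qed.

Lemma bc_P2_dagger3 w : bc_P2 (bc_dagger3 w) = (bc_P2 w)^*.
Proof. exact: bc_P2E. Qed.

Lemma hyperbolic_nonneg_P1 w : hyperbolic_nonneg w -> 0 <= bc_P1 w.
Proof. by case=> x1 [x2 [x1_ge0 _ ->]]; rewrite bc_P1E ler0c. Qed.

Lemma hyperbolic_nonneg_P2 w : hyperbolic_nonneg w -> 0 <= bc_P2 w.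
Proof. by case=> x1 [x2 [_ x2_ge0 ->]]; rewrite bc_P2E ler0c. Qed.

End IdempotentComponents.

Lemma sqr_normcE (R : rcfType) (z : R[i]) : (Normc.normc z ^+ 2)%:C = z * z^*.
(* The norm of [R[i]] is by definition the modulus [normc] embedded in [R[i]]. *)
Proof. by rewrite rmorphXn /= -[_%:C]/(`|z|) sqr_normc. Qed.

(** The hypothesis says that the Hermitian form with Gram matrix entries [a], [c], [c^*], [b] is
    nonnegative at every vector [(z, w)]; a well-chosen vector gives the bound on [c]. *)
Lemma psd_hermitian_cauchy_schwarz (C : numClosedFieldType) (a b c : C) :
  0 <= a -> 0 <= b ->
  (forall z w, 0 <= z * z^*%R * a + w * w^*%R * b
                    + z^*%R * w * c + w^*%R * z * c^*%R) ->
  c * c^*%R <= a * b.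
Proof.
move=> a_ge0 b_ge0 psd.
have [a0|a_neq0] := eqVneq a 0; last first.
  have a_real : a^*%R = a by apply: conj_Creal; apply: ger0_real.
  have a_gt0 : 0 < a by rewrite lt_def a_neq0.
  rewrite -subr_ge0 -(pmulr_rge0 _ a_gt0).
  have := psd (- c) a; rewrite rmorphN /= a_real; congr (0 <= _); ring.
have [b0|b_neq0] := eqVneq b 0; last first.
  have b_real : b^*%R = b by apply: conj_Creal; apply: ger0_real.
  have b_gt0 : 0 < b by rewrite lt_def b_neq0.
  rewrite -subr_ge0 -(pmulr_rge0 _ b_gt0).
  have := psd b (- c^*%R); rewrite rmorphN /= b_real conjCK; congr (0 <= _); ring.
have := psd 1 (- c^*%R); rewrite a0 b0 rmorphN rmorph1 /= conjCK.
rewrite [X in 0 <= X -> _](_ : _ = - (2 * (c * c^*%R))); last by ring.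
by rewrite oppr_ge0 pmulr_rle0 ?ltr0n // mul0r.
Qed.

Section Component.
Variables (R : realType) (M : lmodType (bicomplex R)).
Variable ip : M -> M -> bicomplex R.
Hypothesis ip_sp : bicomplex_scalar_product ip.
Implicit Types (psi phi chi : M).

(** [P] stands for either idempotent projection, so that one argument serves both. *)
Variable P : {rmorphism bicomplex R -> R[i]}.
Hypothesis P_of_complex : forall z, P (bc_of_complex z) = z.
Hypothesis P_dagger3 : forall w, P (bc_dagger3 w) = (P w)^*%C.

Lemma component_hermitian psi phi : P (ip psi phi) = (P (ip phi psi))^*%C.
Proof. by rewrite (bcsp_dagger3 ip_sp) P_dagger3. Qed.

Lemma componentZl alpha psi phi :
  P (ip (alpha *: psi) phi) = (P alpha)^*%C * P (ip psi phi).
Proof.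
rewrite component_hermitian (bcspZr ip_sp) !rmorphM /=.
by rewrite -component_hermitian.
Qed.

Lemma componentDl psi phi chi :
  P (ip (psi + phi) chi) = P (ip psi chi) + P (ip phi chi).
Proof.
rewrite component_hermitian (bcspDr ip_sp) !rmorphD /=.
by rewrite -!component_hermitian.
Qed.

(** Taken at the idempotents, where [P_k e_k = 1], this removes the factors [e_k] from the
    definition of [tnorm]. *)
Lemma component_scale_unit alpha psi : P alpha = 1 ->
  P (ip (alpha *: psi) (alpha *: psi)) = P (ip psi psi).
Proof.
by move=> Pa; rewrite componentZl (bcspZr ip_sp) rmorphM /= Pa rmorph1 !mul1r.
Qed.

Hypothesis P_ge0 : forall psi, 0 <= P (ip psi psi).

Lemma component_Re_ge0 psi : 0 <= complex.Re (P (ip psi psi)).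
Proof. by have := P_ge0 psi; rewrite lecE => /andP[]. Qed.

(** The order of [R[i]] only relates numbers with equal imaginary parts, so a nonnegative one is
    real. *)
Lemma component_ReE psi : P (ip psi psi) = (complex.Re (P (ip psi psi)))%:C.
Proof.
have := P_ge0 psi; rewrite lecE /=.
by case: (P _) => x y /= /andP[/eqP -> _].
Qed.

Lemma component_cauchy_schwarz psi phi :
  Normc.normc (P (ip psi phi)) ^+ 2 <=
  complex.Re (P (ip psi psi)) * complex.Re (P (ip phi phi)).
Proof.
rewrite -lecR sqr_normcE rmorphM /= -!component_ReE.
apply: psd_hermitian_cauchy_schwarz => // z w.
(* The conjugation of a closed field and that of [R[i]] are convertible but must agree syntactically
   for the rewrites below. *)
have conjE (u : R[i]) : u^*%R = u^*%C by [].
rewrite !conjE.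
(* Expanding positivity at this combination by sesquilinearity gives exactly the form required. *)
have := P_ge0 (bc_of_complex z *: psi + bc_of_complex w *: phi).
rewrite componentDl !(bcspDr ip_sp) !rmorphD /= !componentZl !(bcspZr ip_sp).
rewrite !rmorphM /= !P_of_complex (component_hermitian phi psi).
by congr (0 <= _); ring.
Qed.

End Component.

Theorem theorem3p8 (R : realType) (M : lmodType (bicomplex R))
    (ip : M -> M -> bicomplex R) (hM : bicomplex_hilbert ip) (psi phi : M) :
  bc_norm (ip psi phi) <= Num.sqrt 2 * tnorm ip psi * tnorm ip phi.
Proof.
have [ip_sp ip_pos] := bch_prehilbert hM.
have P1_ge0 chi := hyperbolic_nonneg_P1 (ip_pos chi).
have P2_ge0 chi := hyperbolic_nonneg_P2 (ip_pos chi).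
have cs1 := component_cauchy_schwarz ip_sp (P := @bc_P1 R)
  (@bc_P1_of_complex R) (@bc_P1_dagger3 R) P1_ge0 psi phi.
have cs2 := component_cauchy_schwarz ip_sp (P := @bc_P2 R)
  (@bc_P2_of_complex R) (@bc_P2_dagger3 R) P2_ge0 psi phi.
have tnormE chi : tnorm ip chi = (Num.sqrt 2)^-1 * Num.sqrt
    (complex.Re (bc_P1 (ip chi chi)) + complex.Re (bc_P2 (ip chi chi))).
  rewrite /tnorm (component_scale_unit ip_sp (@bc_P1_dagger3 R) chi (bc_P1_e1 R)).
  by rewrite (component_scale_unit ip_sp (@bc_P2_dagger3 R) chi (bc_P2_e2 R)).
have a1_ge0 chi : 0 <= complex.Re (bc_P1 (ip chi chi)).
  exact: (component_Re_ge0 (P := @bc_P1 R) P1_ge0 chi).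
have a2_ge0 chi : 0 <= complex.Re (bc_P2 (ip chi chi)).
  exact: (component_Re_ge0 (P := @bc_P2 R) P2_ge0 chi).
rewrite !tnormE /bc_norm /= in cs1 cs2 *.
have sqrt2_neq0 : Num.sqrt 2 != 0 :> R by rewrite gt_eqF // sqrtr_gt0 ltr0n.
(* The factor [sqrt 2] absorbs one of the two normalisations in the norms; the other cancels against
   that of [bc_norm]. *)
rewrite (mulVKf sqrt2_neq0) mulrCA ler_pM2l ?invr_gt0 ?sqrtr_gt0 ?ltr0n //.
rewrite -sqrtrM ?addr_ge0 ?a1_ge0 ?a2_ge0 // ler_wsqrtr //.
apply: le_trans (lerD cs1 cs2) _.
(* The surplus on the right is the sum of the mixed products [a_1 b_2 + a_2 b_1]. *)
rewrite mulrDl !mulrDr [X in _ <= _ + X]addrC addrACA lerDl.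
by rewrite addr_ge0 ?mulr_ge0.
Qed.
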